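(* Let $\rho>0$ and consider the Mallows culture on candidates $\{1,2,3\}$ with reference ranking $(3,2,1)$ and concentration parameter $\rho$, with $n$ independent voters. Then, as $n\to+\infty$, \[ 1-\mathbb{P}(3\text{ is the Condorcet winner})\sim\sqrt{\frac{2}{\pi n}}\;\frac{e^{-\rho\lceil n/2\rceil}}{1-e^{-\rho}}\left(\frac{2}{1+e^{-\rho}}\right)^n. \]
   Context: Mallows culture with reference ranking $r_0$ and parameter $\rho$: each voter independently draws ranking $r$ with probability $\gamma e^{-\rho d(r,r_0)}$, where $d$ is the Kendall tau distance (number of pairs of candidates ordered differently) and $\gamma$ normalizes. Candidate $3$ is the Condorcet winner if, for each $j\in\{1,2\}$, strictly more than $n/2$ voters rank $3$ above $j$. *)

(* Defs.v *)
From HB Require Import structures.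
From mathcomp Require Import all_boot all_order all_algebra fingroup perm.
From mathcomp Require Import all_classical all_reals all_analysis.
Set Implicit Arguments. Unset Strict Implicit. Unset Printing Implicit Defensive.
Import Order.TTheory GRing.Theory Num.Theory.
Local Open Scope ring_scope.

(* Candidates 1,2,3 are encoded as 0,1,2 : 'I_3 (candidate k <-> k-1).
   A ranking is a permutation r : {perm 'I_3} with r c = position of candidate c
   (position 0 = top).  Candidate a is ranked above b by r iff r a < r b. *)
Definition ranking := {perm 'I_3}.

Definition above (r : ranking) (a b : 'I_3) : bool := (r a < r b)%N.

Definition kendall (r s : ranking) : nat :=
  #|[set p : 'I_3 * 'I_3 | (p.1 < p.2)%N && (above r p.1 p.2 != above s p.1 p.2)]|.

(* Reference ranking (3,2,1): candidate 3 first, then 2, then 1,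
   i.e. candidate c (index c) sits at position 2 - c. *)
Definition ref_pos (c : 'I_3) : 'I_3 := rev_ord c.
Lemma ref_pos_inj : injective ref_pos.
Proof. exact: rev_ord_inj. Qed.
Definition ref_ranking : ranking := perm ref_pos_inj.

Definition mallows_weight (R : realType) (rho : R) (r : ranking) : R :=
  expR (- rho * (kendall r ref_ranking)%:R).
Definition mallows (R : realType) (rho : R) (r : ranking) : R :=
  mallows_weight rho r / \sum_(s : ranking) mallows_weight rho s.

Definition profile (n : nat) := {ffun 'I_n -> ranking}.

Definition cand3 : 'I_3 := inord 2.
Definition cand1 : 'I_3 := inord 0.
Definition cand2 : 'I_3 := inord 1.

Definition nprefer n (p : profile n) (a b : 'I_3) : nat :=
  #|[set i : 'I_n | above (p i) a b]|.

Definition condorcet3 n (p : profile n) : bool :=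
  [forall j : 'I_3, (j != cand3) ==> (n < 2 * nprefer p cand3 j)%N].

Definition prob_condorcet3 (R : realType) (rho : R) (n : nat) : R :=
  \sum_(p : profile n | condorcet3 p) \prod_(i < n) mallows rho (p i).

(* Main.v *)
Require Import Defs.
From HB Require Import structures.
From mathcomp Require Import all_boot all_order all_algebra fingroup perm.
From mathcomp Require Import all_classical all_reals all_analysis.
From mathcomp Require Import ring lra zify.
Import Order.TTheory GRing.Theory Num.Theory.
Import numFieldNormedType.Exports.
Local Open Scope ring_scope.

(* Put q = e^-rho and m = ceil(n/2).  A voter ranks 2 above 3 with probability
   b = q / (1 + q), and 1 above 3 with a probability c < b < 1/2.  Candidate 3
   fails to be the Condorcet winner iff at least m voters agree on 2 above 3, or
   at least m voters agree on 1 above 3, so the failure probability lies between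
   the binomial tail at b and the sum of the binomial tails at b and c.  The tail
   at b is its first term 'C(n, m) b^m (1 - b)^(n - m) times a sum that converges
   to the geometric series of ratio b / (1 - b) = q; the tail at c is smaller by
   the factor (c (1 - c) / (b (1 - b)))^m, up to a constant.  Wallis' formula
   gives the asymptotics of 'C(n, m). *)

(** * The voting model *)

(** Probability of at least [m] successes in [n] independent trials of success rate [x]. *)
Definition binomial_tail {R : realType} (n m : nat) (x : R) : R :=
  \sum_(m <= k < n.+1) 'C(n, k)%:R * (x ^+ k * (1 - x) ^+ (n - k)).

(** Prescribing the set of voters that satisfy [P] constrains each voter separately, so the sum of
    products factors into a product of sums. *)
Lemma sum_prod_set_eq {R : realType} {T : finType} (f : T -> R) (P : pred T)
    (n : nat) (A : {set 'I_n}) :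
  \sum_(p : {ffun 'I_n -> T} | [set i | P (p i)] == A) \prod_(i < n) f (p i)
  = (\sum_(t | P t) f t) ^+ #|A| * (\sum_(t | ~~ P t) f t) ^+ (n - #|A|).
Proof.
rewrite (eq_bigl (fun p => p \in family (fun i t => P t == (i \in A)))); last first.
  move=> p; apply/eqP/familyP => [<- i|pA].
    by change (P (p i) == (i \in [set j | P (p j)])); rewrite inE.
  by apply/setP => i; rewrite inE; apply/eqP/(pA i).
rewrite -(bigA_distr_big_dep (fun i t => P t == (i \in A)) (fun _ t => f t)).
rewrite (bigID (mem A)) /=; congr (_ * _).
  rewrite -prodr_const; apply: eq_bigr => i iA.
  by apply: eq_bigl => t; rewrite iA eqb_id.
have -> : (n - #|A|)%N = #|~: A| by rewrite [in RHS]cardsCs finset.setCK card_ord.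
rewrite -prodr_const; apply: eq_big => i; first by rewrite inE.
by move=> iA; apply: eq_bigl => t; rewrite (negbTE iA) eqbF_neg.
Qed.

(** All ['C(n, k)] sets of size [k] contribute the same amount. *)
Lemma sum_prod_card_eq {R : realType} {T : finType} (f : T -> R) (P : pred T)
    (n k : nat) :
  \sum_(p : {ffun 'I_n -> T} | #|[set i | P (p i)]| == k) \prod_(i < n) f (p i)
  = 'C(n, k)%:R * ((\sum_(t | P t) f t) ^+ k * (\sum_(t | ~~ P t) f t) ^+ (n - k)).
Proof.
rewrite (partition_big (fun p : {ffun 'I_n -> T} => [set i | P (p i)])
  (fun A : {set 'I_n} => #|A| == k)) //=.
rewrite (eq_bigr (fun=> (\sum_(t | P t) f t) ^+ k * (\sum_(t | ~~ P t) f t) ^+ (n - k))).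
  rewrite sumr_const -[X in 'C(X, k)]card_ord -card_draws mulr_natl.
  by congr (_ *+ _); apply: eq_card => A; rewrite !inE.
move=> A /eqP cA; rewrite -{2 3}cA -sum_prod_set_eq; apply: eq_bigl => p.
by apply: andb_idl => /eqP ->; rewrite cA.
Qed.

Lemma sum_prod_card_ge {R : realType} {T : finType} (f : T -> R) (P : pred T)
    (n m : nat) : \sum_t f t = 1 ->
  \sum_(p : {ffun 'I_n -> T} | (m <= #|[set i | P (p i)]|)%N) \prod_(i < n) f (p i)
  = binomial_tail n m (\sum_(t | P t) f t).
Proof.
move=> f1.
have fC : \sum_(t | ~~ P t) f t = 1 - \sum_(t | P t) f t.
  by rewrite -f1 [in RHS](bigID P) /= addrAC subrr add0r.
(* The count is at most [n], so passing through [inord] loses nothing. *)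
rewrite (partition_big (fun p : {ffun 'I_n -> T} => inord #|[set i | P (p i)]|)
  (fun k : 'I_n.+1 => (m <= k)%N)) /=; last first.
  by move=> p; rewrite inordK// ltnS -[leqRHS]card_ord max_card.
rewrite /binomial_tail big_geq_mkord; apply: eq_bigr => k mk.
rewrite -fC -sum_prod_card_eq; apply: eq_bigl => p.
rewrite -val_eqE /= inordK; last by rewrite ltnS -[leqRHS]card_ord max_card.
by apply/andP/idP => [[]//|/eqP kE]; rewrite kE.
Qed.

(* A permutation of 'I_3 is encoded by its triple of values, so that a sum over the
   six rankings becomes a computable sum over an explicit list of triples. *)
Lemma sum_perm3 {R : realType} (F : nat * nat * nat -> R) :
  \sum_(r : {perm 'I_3}) F (val (r cand1), val (r cand2), val (r cand3)) =
  F (0, 1, 2)%N + F (0, 2, 1)%N + F (1, 0, 2)%N + F (1, 2, 0)%N + F (2, 0, 1)%N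
  + F (2, 1, 0)%N.
Proof.
pose h (r : {perm 'I_3}) := (val (r cand1), val (r cand2), val (r cand3)).
pose L := [:: (0, 1, 2); (0, 2, 1); (1, 0, 2); (1, 2, 0); (2, 0, 1); (2, 1, 0)]%N.
have cand_all (i : 'I_3) : [\/ i = cand1, i = cand2 | i = cand3].
  by case: i => [[|[|[|//]]] ?]; [constructor 1|constructor 2|constructor 3];
     apply: val_inj; rewrite /= inordK.
have hinj : injective h.
  move=> r s [/val_inj e1 /val_inj e2 /val_inj e3].
  by apply/permP => i; case: (cand_all i) => ->.
have hL : {subset map h (enum {perm 'I_3}) <= L}.
  move=> _ /mapP[r _ ->]; rewrite /h.
  have d12 : val (r cand1) != val (r cand2).
    by rewrite val_eqE (inj_eq perm_inj) -val_eqE /= !inordK.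
  have d13 : val (r cand1) != val (r cand3).
    by rewrite val_eqE (inj_eq perm_inj) -val_eqE /= !inordK.
  have d23 : val (r cand2) != val (r cand3).
    by rewrite val_eqE (inj_eq perm_inj) -val_eqE /= !inordK.
  move: d12 d13 d23 (ltn_ord (r cand1)) (ltn_ord (r cand2)) (ltn_ord (r cand3)) => /=.
  case: (nat_of_ord (r cand1)) => [|[|[|//]]];
    case: (nat_of_ord (r cand2)) => [|[|[|//]]];
    by case: (nat_of_ord (r cand3)) => [|[|[|//]]].
have uh : uniq (map h (enum {perm 'I_3})) by rewrite map_inj_uniq ?enum_uniq.
(* Six distinct triples that all lie in the six-element list [L] exhaust it. *)
have pL : perm_eq (map h (enum {perm 'I_3})) L.
  apply: uniq_perm => //.
  by case: (uniq_min_size uh hL) => //; rewrite size_map -cardT card_Sn.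
rewrite -big_enum /= -(big_map h xpredT F) (perm_big _ pL) /=.
by rewrite /L !big_cons big_nil !addrA addr0.
Qed.

(** The reference reverses the order of the indices, so a pair a < b is discordant exactly when [r]
    ranks a above b. *)
Lemma kendall_ref (r : ranking) :
  kendall r ref_ranking =
  (above r cand1 cand2 + above r cand1 cand3 + above r cand2 cand3)%N.
Proof.
rewrite /kendall.
have -> : [set p : 'I_3 * 'I_3 | (p.1 < p.2)%N &&
     (above r p.1 p.2 != above ref_ranking p.1 p.2)] =
  [set p : 'I_3 * 'I_3 | (p.1 < p.2)%N && above r p.1 p.2].
  apply/setP => -[a b]; rewrite !inE /=; case: ltnP => //= ab.
  rewrite [X in _ != X](_ : _ = false) ?eqbF_neg ?negbK//.
  by rewrite /above /ref_ranking !permE /=; apply/negbTE; rewrite -leqNgt leq_sub2l// ltnS ltnW.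
transitivity (\sum_(a : 'I_3) \sum_(b : 'I_3) ((a < b) && above r a b))%N.
  rewrite pair_bigA /= -sum1_card big_mkcond /=; apply: eq_bigr => -[a b] _.
  by rewrite inE /=; case: (_ && _).
rewrite !big_ord_recl !big_ord0 /= !addn0 !add0n.
have -> : ord0 = cand1 by apply: val_inj; rewrite /= inordK.
have -> : lift cand1 ord0 = cand2 by apply: val_inj; rewrite /= /bump !inordK.
have -> // : lift cand1 (lift ord0 ord0) = cand3.
by apply: val_inj; rewrite /= /bump !inordK.
Qed.

(** The exponent of q is the number of increasing pairs in the triple of positions. Events given on
    triples can be evaluated by computation. *)
Lemma sum_mallows_weight {R : realType} (rho : R) (P : nat * nat * nat -> bool) :
  let q := expR (- rho) in
  \sum_(r : ranking | P (val (r cand1), val (r cand2), val (r cand3)))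
    mallows_weight rho r =
  (P (0, 1, 2)%N)%:R * q ^+ 3 + (P (0, 2, 1)%N)%:R * q ^+ 2
  + (P (1, 0, 2)%N)%:R * q ^+ 2 + (P (1, 2, 0)%N)%:R * q
  + (P (2, 0, 1)%N)%:R * q + (P (2, 1, 0)%N)%:R.
Proof.
move=> q.
pose F (t : nat * nat * nat) : R := (P t)%:R *
  q ^+ ((t.1.1 < t.1.2) + (t.1.1 < t.2) + (t.1.2 < t.2))%N.
transitivity (F (0, 1, 2)%N + F (0, 2, 1)%N + F (1, 0, 2)%N
  + F (1, 2, 0)%N + F (2, 0, 1)%N + F (2, 1, 0)%N); last by rewrite /F /= mulr1.
rewrite -sum_perm3 big_mkcond /=; apply: eq_bigr => r _.
rewrite /F /= -/(above r cand1 cand2) -/(above r cand1 cand3) -/(above r cand2 cand3).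
rewrite -kendall_ref /mallows_weight /q -expRM_natr; case: ifP => _; rewrite ?mul0r ?mul1r//.
Qed.

(* With q = e^-rho, lose23 q and lose13 q are the probabilities that a voter ranks
   candidate 2, respectively candidate 1, above candidate 3. *)
Definition lose23 {R : realType} (q : R) : R := q / (1 + q).
Definition lose13 {R : realType} (q : R) : R :=
  q ^+ 2 * (2 + q) / ((1 + q) * (1 + q + q ^+ 2)).

Lemma sum_mallows_weightT {R : realType} (rho : R) (q := expR (- rho)) :
  \sum_(r : ranking) mallows_weight rho r = (1 + q) * (1 + q + q ^+ 2).
Proof.
rewrite (sum_mallows_weight rho xpredT) -/q /=; ring.
Qed.

Lemma sum_mallows {R : realType} (rho : R) : \sum_(r : ranking) mallows rho r = 1.
Proof.
rewrite -mulr_suml divff// sum_mallows_weightT.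
by have q0 := expR_gt0 (- rho); apply: lt0r_neq0; nra.
Qed.

Lemma sum_mallows_lose23 {R : realType} (rho : R) :
  \sum_(r : ranking | ~~ above r cand3 cand2) mallows rho r = lose23 (expR (- rho)).
Proof.
have q0 := expR_gt0 (- rho).
rewrite -mulr_suml sum_mallows_weightT.
rewrite (sum_mallows_weight rho (fun t => ~~ (t.2 < t.1.2)%N)) /= /lose23.
by field; apply/andP; split; apply: lt0r_neq0; nra.
Qed.

Lemma sum_mallows_lose13 {R : realType} (rho : R) :
  \sum_(r : ranking | ~~ above r cand3 cand1) mallows rho r = lose13 (expR (- rho)).
Proof.
have q0 := expR_gt0 (- rho).
rewrite -mulr_suml sum_mallows_weightT.
rewrite (sum_mallows_weight rho (fun t => ~~ (t.2 < t.1.1)%N)) /= /lose13.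
by field; apply/andP; split; apply: lt0r_neq0; nra.
Qed.

Lemma mallows_ge0 {R : realType} (rho : R) (r : ranking) : 0 <= mallows rho r.
Proof. by rewrite divr_ge0 ?expR_ge0// sumr_ge0// => s _; rewrite expR_ge0. Qed.

Lemma prob_not_condorcet3 {R : realType} (rho : R) (n : nat) :
  1 - prob_condorcet3 rho n =
  \sum_(p : profile n | ~~ condorcet3 p) \prod_(i < n) mallows rho (p i).
Proof.
have tot : \sum_(p : profile n) \prod_(i < n) mallows rho (p i) = 1.
  rewrite -(bigA_distr_bigA (fun (i : 'I_n) r => mallows rho r)).
  by rewrite sum_mallows prodr_const expr1n.
by rewrite -[X in X - _]tot (bigID (@condorcet3 n)) /= addrAC subrr add0r.
Qed.

(** Ties count against [a]: if x voters prefer [a], then 2x <= n iff n - x >= n/2, and n - x is an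
    integer. *)
Lemma nprefer_uphalf (n : nat) (p : profile n) (a b : 'I_3) :
  (uphalf n <= #|[set i | ~~ above (p i) a b]|)%N = ~~ (n < 2 * nprefer p a b)%N.
Proof.
rewrite /nprefer (_ : [set i | ~~ above (p i) a b] = ~: [set i | above (p i) a b]).
  have := cardsC [set i | above (p i) a b]; rewrite card_ord.
  have := odd_double_half n; rewrite uphalf_half.
  by move: (#|_|) (#|_|) => x y; case: odd => /= ? ?; apply/idP/idP; lia.
by apply/setP => i; rewrite !inE.
Qed.

(** Failing against candidate 2 alone already excludes candidate 3. *)
Lemma prob_not_condorcet3_ge {R : realType} (rho : R) (n : nat) :
  binomial_tail n (uphalf n) (lose23 (expR (- rho))) <= 1 - prob_condorcet3 rho n.
Proof.
rewrite prob_not_condorcet3 -sum_mallows_lose23.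
rewrite -(sum_prod_card_ge _ (fun r => ~~ above r cand3 cand2)) ?sum_mallows//.
rewrite big_mkcond [leRHS]big_mkcond /=; apply: ler_sum => p _.
have pr0 : 0 <= \prod_(i < n) mallows rho (p i).
  by apply: prodr_ge0 => i _; exact: mallows_ge0.
rewrite nprefer_uphalf; case: ifP => [H|_]; last by case: ifP.
rewrite (_ : condorcet3 p = false)//; apply/negbTE/forallPn; exists cand2.
by rewrite negb_imply H andbT -val_eqE /= !inordK.
Qed.

(** Union bound over the two possible opponents. *)
Lemma prob_not_condorcet3_le {R : realType} (rho : R) (n : nat) :
  1 - prob_condorcet3 rho n <= binomial_tail n (uphalf n) (lose23 (expR (- rho)))
    + binomial_tail n (uphalf n) (lose13 (expR (- rho))).
Proof.
rewrite prob_not_condorcet3 -sum_mallows_lose23 -sum_mallows_lose13.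
rewrite -(sum_prod_card_ge _ (fun r => ~~ above r cand3 cand2)) ?sum_mallows//.
rewrite -(sum_prod_card_ge _ (fun r => ~~ above r cand3 cand1)) ?sum_mallows//.
rewrite big_mkcond [X in _ <= X + _]big_mkcond [X in _ <= _ + X]big_mkcond /= -big_split /=.
apply: ler_sum => p _ /=.
have pr0 : 0 <= \prod_(i < n) mallows rho (p i).
  by apply: prodr_ge0 => i _; exact: mallows_ge0.
rewrite !nprefer_uphalf.
case c3 : (condorcet3 p) => /=; first by rewrite addr_ge0//; case: ifP.
have /forallPn[j] := negbT c3; rewrite negb_imply => /andP[j3 H].
have [jE|jE] : j = cand1 \/ j = cand2.
  case: j j3 {H} => [[|[|[|//]]] lt]; rewrite -val_eqE /= inordK// => _;
    by [left; apply: val_inj; rewrite /= inordK|right; apply: val_inj; rewrite /= inordK].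
  by rewrite -jE H lerDr; case: ifP.
by rewrite -jE H lerDl; case: ifP.
Qed.

(** * Wallis' formula *)

Local Open Scope classical_set_scope.
Local Open Scope ring_scope.

(* The explicit primitives of sin^n turn the Wallis integrals into differences of
   values, so that no integration theory is needed. *)
Fixpoint sinX_primitive {R : realType} (n : nat) (x : R) : R :=
  match n with
  | 0%N => x
  | 1%N => - cos x
  | k.+2 => k.+1%:R / k.+2%:R * sinX_primitive k x
            - k.+2%:R^-1 * (cos x * sin x ^+ k.+1)
  end.

Lemma nat_ind2 (P : nat -> Prop) :
  P 0%N -> P 1%N -> (forall n, P n -> P n.+2) -> forall n, P n.
Proof.
move=> P0 P1 PS n; suff [] : P n /\ P n.+1 by [].
by elim: n => // n [? ?]; split=> //; apply: PS.
Qed.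

Lemma is_derive_sinX_primitive {R : realType} (n : nat) (x : R) :
  is_derive x 1 (sinX_primitive n) (sin x ^+ n).
Proof.
elim/nat_ind2: n => [||n IH] /=.
- exact: is_derive_id.
- have -> : sin x ^+ 1 = - - sin x by rewrite opprK.
  exact: is_deriveN.
- have -> : (fun x : R => n.+1%:R / n.+2%:R * sinX_primitive n x
       - n.+2%:R^-1 * (cos x * sin x ^+ n.+1)) =
    (n.+1%:R / n.+2%:R : R) \*: sinX_primitive n
      - (n.+2%:R^-1 : R) \*: ((@cos R) * (@sin R) ^+ n.+1).
    by apply/funext => y /=; rewrite !fctE.
  apply: is_derive_eq.
  rewrite !fctE /GRing.scale /=.
  have n2 : n.+2%:R != 0 :> R by rewrite pnatr_eq0.
  have cs : cos x * cos x = 1 - sin x * sin x by rewrite -!expr2 cos2sin2.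
  (* Once cos^2 is replaced by 1 - sin^2, the multiples of sin^n cancel and sin^(n+2) remains. *)
  transitivity (n.+1%:R / n.+2%:R * sin x ^+ n - n.+2%:R^-1 *
      (n.+1%:R * sin x ^+ n * (cos x * cos x) - sin x * sin x * sin x ^+ n)).
    by rewrite exprS; ring.
  by rewrite cs !exprS -natr1 -[n.+1%:R]natr1 in n2 *; field.
Qed.

(** The Wallis integral W_n of sin^n over [0, pi/2]. *)
Definition wallis {R : realType} (n : nat) : R :=
  sinX_primitive n (pi / 2) - sinX_primitive n 0.

Lemma wallis0 {R : realType} : wallis 0 = pi / 2 :> R.
Proof. by rewrite /wallis /= subr0. Qed.

Lemma wallis1 {R : realType} : wallis 1 = 1 :> R.
Proof. by rewrite /wallis /= cos_pihalf cos0 oppr0 sub0r opprK. Qed.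

(** The boundary term cos * sin^(n+1) vanishes at both 0 and pi/2. *)
Lemma wallisSS {R : realType} (n : nat) :
  wallis n.+2 = n.+1%:R / n.+2%:R * wallis n :> R.
Proof.
rewrite /wallis /= cos_pihalf sin0 expr0n /= !mul0r !mulr0 !subr0.
by rewrite mulrBr.
Qed.

Lemma wallis_gt0 {R : realType} (n : nat) : 0 < wallis n :> R.
Proof.
elim/nat_ind2: n => [||n IH]; rewrite ?wallis0 ?wallis1 ?wallisSS //.
  by rewrite divr_gt0 ?pi_gt0.
by rewrite mulr_gt0 ?divr_gt0.
Qed.

(** The difference of the two primitives has derivative sin^n - sin^(n+1) >= 0 on [0, pi/2]; the
    mean value theorem concludes. *)
Lemma wallis_nonincr {R : realType} (n : nat) : wallis n.+1 <= wallis n :> R.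
Proof.
pose f : R -> R := sinX_primitive n - sinX_primitive n.+1.
have df (x : R) : is_derive x 1 f (sin x ^+ n - sin x ^+ n.+1).
  by apply: is_deriveB; exact: is_derive_sinX_primitive.
have pih0 : 0 <= pi / 2 :> R by rewrite divr_ge0 ?pi_ge0.
have cf : {within `[0, pi / 2], continuous f}.
  apply: continuous_subspaceT => x.
  by apply/differentiable_continuous/derivable1_diffP; case: (df x).
have [c] := MVT_segment pih0 (fun x _ => df x) cf.
rewrite in_itv /= => /andP[c0 cpi] fE.
have s0 : 0 <= sin c.
  by apply: sin_ge0_pi; rewrite c0 (le_trans cpi)// ler_pdivrMr// ler_peMr ?pi_ge0// ler1n.
rewrite -subr_ge0 (_ : _ - _ = f (pi / 2) - f 0); last first.
  by rewrite /f /wallis !fctE; ring.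
rewrite fE subr0 mulr_ge0// subr_ge0 exprSr ler_piMr ?sin_le1//.
exact: exprn_ge0.
Qed.

(** By the two-step recurrence the left side does not change from n to n + 1, and at n = 0 it is
    pi/2. *)
Lemma wallis_mulS {R : realType} (n : nat) :
  n.+1%:R * wallis n * wallis n.+1 = pi / 2 :> R.
Proof.
elim: n => [|n IH]; first by rewrite wallis0 wallis1 mul1r mulr1.
rewrite -IH wallisSS.
have n2 : n.+2%:R != 0 :> R by rewrite pnatr_eq0.
by rewrite -[n.+2%:R]natr1 in n2 *; field.
Qed.

Lemma wallis_double {R : realType} (k : nat) :
  wallis k.*2 = pi / 2 * ('C(k.*2, k)%:R / 2 ^+ k.*2) :> R.
Proof.
elim: k => [|k IH]; first by rewrite wallis0 bin0 expr0 divr1 mulr1.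
rewrite doubleS wallisSS IH.
have e : (k.+1 * 'C(k.*2.+2, k.+1) = 2 * k.*2.+1 * 'C(k.*2, k))%N.
  have := mul_bin_diag k.*2.+2 k; have := mul_bin_diag k.*2.+1 k => /=.
  have := mul_bin_down k.*2.+1 k => /=.
  have -> : (k.*2.+1 - k = k.+1)%N by rewrite -addnn -addSn addnK.
  by move=> /=; rewrite -!mul2n; nia.
have {e} : k.+1%:R * 'C(k.*2.+2, k.+1)%:R = 2 * k.*2.+1%:R * 'C(k.*2, k)%:R :> R.
  by rewrite -!natrM e.
have k1 : k.+1%:R != 0 :> R by rewrite pnatr_eq0.
have -> : k.*2.+2%:R = 2 * k.+1%:R :> R by rewrite -natrM -doubleS -mul2n.
move=> /(canRL (mulKf k1)) ->; rewrite !exprS.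
have p2 : 2 ^+ k.*2 != 0 :> R by rewrite expf_neq0.
by field; rewrite p2 addrC natr1 k1.
Qed.

(** Reduces odd n to a central coefficient: for n = 2k + 1, Pascal's rule and symmetry give C(2k+2,
    k+1) = 2 C(2k+1, k+1). *)
Lemma bin_uphalf_double (n : nat) :
  ('C(n, uphalf n) * 2 ^ (uphalf n).*2 = 'C((uphalf n).*2, uphalf n) * 2 ^ n)%N.
Proof.
have [b [k ->]] : exists (b : bool) k, n = (b + k.*2)%N.
  by exists (odd n), n./2; rewrite odd_double_half.
case: b; last by rewrite add0n uphalf_double.
rewrite add1n uphalfE -doubleS doubleK doubleS [in RHS]binS.
have -> : 'C(k.*2.+1, k.+1) = 'C(k.*2.+1, k).
  by rewrite -bin_sub; [congr 'C(_, _); lia|lia].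
rewrite !expnS; nia.
Qed.

(** With j = [uphalf n], W_2j lies between W_(2j+1) and W_(2j-1). The product identity turns this
    into bounds on the squared central coefficient, and n <= 2j <= n + 1 restores n. *)
Lemma bin_uphalf_bounds {R : realType} (n : nat) : (0 < n)%N ->
  n%:R / n.+2%:R <= ('C(n, uphalf n)%:R / 2 ^+ n) ^+ 2 * ((pi : R) * n%:R / 2) <= 1.
Proof.
move=> n0; set j := uphalf n.
have -> : 'C(n, j)%:R / 2 ^+ n = 'C(j.*2, j)%:R / 2 ^+ j.*2 :> R.
  by apply/eqP; rewrite eqr_div ?expf_neq0// -!natrX -!natrM -bin_uphalf_double.
set b := ('C(_, _)%:R / _).
have pi0 := @pi_gt0 R.
have wE : wallis j.*2 = pi / 2 * b :> R by rewrite wallis_double.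
have j0 : (0 < j)%N by rewrite uphalf_gt0.
have nj : (n <= j.*2)%N by have := odd_double_half n; rewrite /j uphalf_half doubleD; case: (odd n) => /=; lia.
have jn : (j.*2.+1 <= n.+2)%N by have := odd_double_half n; rewrite /j uphalf_half doubleD; case: (odd n) => /=; lia.
have b0 : 0 < b.
  by rewrite /b divr_gt0 ?exprn_gt0// ltr0n bin_gt0 -addnn leq_addr.
have lo : 1 <= b ^+ 2 * (pi / 2) * j.*2.+1%:R.
  have := @wallis_mulS R j.*2; have := @wallis_nonincr R j.*2; rewrite wE.
  set v := wallis _ => v1 v2.
  have : pi / 2 <= j.*2.+1%:R * (pi / 2 * b) * (pi / 2 * b).
    rewrite -[leLHS]v2; apply: ler_pM => //.
    + by rewrite !mulr_ge0// ltW// divr_gt0.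
    + exact/ltW/wallis_gt0.
  have -> : j.*2.+1%:R * (pi / 2 * b) * (pi / 2 * b) =
    pi / 2 * (b ^+ 2 * (pi / 2) * j.*2.+1%:R) by ring.
  by rewrite ler_pMr// divr_gt0.
have hi : b ^+ 2 * (pi / 2) * j.*2%:R <= 1.
  have := @wallis_mulS R j.*2.-1; have := @wallis_nonincr R j.*2.-1.
  rewrite prednK ?double_gt0// wE.
  set v := wallis _ => v1 v2.
  have : j.*2%:R * (pi / 2 * b) * (pi / 2 * b) <= pi / 2.
    rewrite -[leRHS]v2 ler_pM2r; last by rewrite mulr_gt0// divr_gt0.
    by rewrite ler_wpM2l.
  have -> : j.*2%:R * (pi / 2 * b) * (pi / 2 * b) =
    pi / 2 * (b ^+ 2 * (pi / 2) * j.*2%:R) by ring.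
  by rewrite ger_pMr// divr_gt0.
have -> : b ^+ 2 * (pi * n%:R / 2) = b ^+ 2 * (pi / 2) * n%:R by ring.
have c0 : 0 < b ^+ 2 * (pi / 2) by apply: mulr_gt0; [exact: exprn_gt0|exact: divr_gt0].
apply/andP; split.
  rewrite mulrC ler_wpM2r// -[leLHS]mul1r ler_pdivrMr//.
  by apply: (le_trans lo); rewrite ler_wpM2l ?ler_nat// ltW.
by apply: le_trans hi; rewrite ler_wpM2l ?ler_nat// ltW.
Qed.

(** * Binomial tails *)

(* The first, dominant term of binomial_tail n (uphalf n) x. *)
Definition binomial_mid {R : realType} (n : nat) (x : R) : R :=
  'C(n, uphalf n)%:R * (x ^+ uphalf n * (1 - x) ^+ (n - uphalf n)).

Lemma uphalf_bounds (n : nat) :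
  [/\ (uphalf n <= n)%N, (n - uphalf n <= uphalf n)%N & (uphalf n <= (n - uphalf n).+1)%N].
Proof.
have := odd_double_half n; rewrite uphalf_half.
by case: (odd n) => /= ?; split; lia.
Qed.

Lemma bin_uphalf_le (n j : nat) :
  ('C(n, j.+1 + uphalf n) <= 'C(n, j + uphalf n) <= 'C(n, uphalf n))%N.
Proof.
have S i : ('C(n, i.+1 + uphalf n) <= 'C(n, i + uphalf n))%N.
  have [_ h _] := uphalf_bounds n.
  rewrite -(leq_pmul2l (ltn0Sn (i + uphalf n))) addSn mul_bin_left leq_mul2r.
  by apply/orP; right; lia.
rewrite S /=; elim: j => // j; apply: leq_trans; exact: S.
Qed.

(** With m = [uphalf n], passing from offset u - 1 to u multiplies the coefficient by at least (m -
    u)/(m + u), a relative loss of at most 2u/m. The losses for u = 1, ..., j add up to j(j +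
    1)/m. *)
Lemma bin_uphalf_ge {R : realType} (n j : nat) : (0 < n)%N ->
  'C(n, uphalf n)%:R * (1 - (j * j.+1)%:R / (uphalf n)%:R) <= 'C(n, j + uphalf n)%:R :> R.
Proof.
move=> n0; have [mn rm mr] := uphalf_bounds n.
have m0 : (0 < uphalf n)%N by rewrite uphalf_gt0.
have m0R : 0 < (uphalf n)%:R :> R by rewrite ltr0n.
elim: j => [|j IH]; first by rewrite mul0n mul0r subr0 mulr1.
(* Beyond n the coefficient is 0, and the claimed lower bound is then nonpositive. *)
have [jr|rj] := ltnP j (n - uphalf n); last first.
  rewrite (bin_small (_ : n < j.+1 + uphalf n)%N); last by lia.
  rewrite mulr_ge0_le0// subr_le0 ler_pdivlMr// mul1r ler_nat.
  by have := leq_mul (_ : uphalf n <= j.+1)%N (_ : 1 <= j.+2)%N; rewrite muln1; apply; lia.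
have e : (j.+1 + uphalf n)%:R * 'C(n, j.+1 + uphalf n)%:R =
         (n - uphalf n - j)%:R * 'C(n, j + uphalf n)%:R :> R.
  by rewrite -!natrM addSn mul_bin_left addnC subnDA.
have /andP[_ le0] := bin_uphalf_le n j.
have {le0} le0 : 'C(n, j + uphalf n)%:R <= 'C(n, uphalf n)%:R :> R by rewrite ler_nat.
have d0 : 0 < (j.+1 + uphalf n)%:R :> R by rewrite ltr0n.
rewrite -[leRHS](mulKf (lt0r_neq0 d0)) e ler_pdivlMl//.
have rE : (uphalf n)%:R - j.+1%:R <= (n - uphalf n - j)%:R :> R.
  by rewrite lerBlDr -natrD ler_nat; lia.
set c := 'C(n, j + uphalf n)%:R in e le0 IH *; set c0 := 'C(n, uphalf n)%:R in le0 IH *.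
set m := (uphalf n)%:R in m0R rE IH *.
have c_ge0 : 0 <= c by rewrite ler0n.
apply: (@le_trans _ _ ((m - j.+1%:R) * c)); last by rewrite ler_wpM2r.
set u := j.+1%:R.
have uj : 0 < u :> R by rewrite ltr0n.
have IH' : c0 * (m - (u - 1) * u) <= m * c.
  have := IH; rewrite natrM -[j%:R](addrK 1) natr1 -/u => H.
  have := ler_wpM2l (ltW m0R) H; congr (_ <= _); field; exact: lt0r_neq0.
rewrite natrD -/u -/m natrM -/u -[j.+2%:R]natr1 -/u.
(* The induction hypothesis scaled by 1 + u/m, minus a remainder of at least 2 u c0, which dominates
   2 u c because c <= c0. *)
have -> : (u + m) * (c0 * (1 - u * (u + 1) / m)) =
    (1 + u / m) * (c0 * (m - (u - 1) * u)) - (1 + u / m) * (2 * u * c0).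
  by field; exact: lt0r_neq0.
have um : 0 <= u / m by rewrite divr_ge0// ltW.
have uc : u * c <= u * c0 by rewrite ler_wpM2l// ltW.
have uc0 : 0 <= u * c0 by rewrite (le_trans _ uc)// mulr_ge0// ltW.
have h1 : (1 + u / m) * (c0 * (m - (u - 1) * u)) <= (m + u) * c.
  have -> : (m + u) * c = (1 + u / m) * (m * c) by field; exact: lt0r_neq0.
  by rewrite ler_wpM2l// addr_ge0.
have h2 : 2 * u * c0 <= (1 + u / m) * (2 * u * c0).
  by rewrite ler_peMl ?lerDl// -mulrA mulr_ge0.
by lra.
Qed.

Lemma odds_bounds {R : realType} (x : R) : 0 < x -> x < 1 / 2 ->
  0 < x / (1 - x) < 1.
Proof.
move=> x0 x1; have y0 : 0 < 1 - x by lra.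
by rewrite divr_gt0//= ltr_pdivrMr//; lra.
Qed.

(** Writing k = m + j, each further success replaces a factor 1 - x by x, which leaves powers of the
    odds. *)
Lemma binomial_tail_uphalfE {R : realType} (n : nat) (x : R) : x < 1 ->
  binomial_tail n (uphalf n) x = x ^+ uphalf n * (1 - x) ^+ (n - uphalf n) *
    \sum_(j < (n - uphalf n).+1) 'C(n, j + uphalf n)%:R * (x / (1 - x)) ^+ j.
Proof.
move=> x1; have [mn _ _] := uphalf_bounds n.
rewrite /binomial_tail -{1}[uphalf n]add0n big_addn subSn// big_mkord mulr_sumr.
apply: eq_bigr => j _; rewrite exprD expr_div_n.
have -> : (n - (j + uphalf n) = n - uphalf n - j)%N by rewrite addnC subnDA.
have -> : (1 - x) ^+ (n - uphalf n) = (1 - x) ^+ (n - uphalf n - j) * (1 - x) ^+ j.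
  by rewrite -exprD subnK// -ltnS.
have y0 : (1 - x) ^+ j != 0 by rewrite expf_neq0//; apply: lt0r_neq0; lra.
by field.
Qed.

Lemma sum_expr {R : realType} (N : nat) (t : R) : t != 1 ->
  \sum_(j < N) t ^+ j = (1 - t ^+ N) / (1 - t).
Proof.
move=> t1; have t1' : t - 1 != 0 by rewrite subr_eq0.
rewrite -[LHS](mulKf t1') -subrX1 mulrC -mulrNN -invrN; congr (_ / _); ring.
Qed.

(** The bound is the value of the full series; telescoping an explicit nonnegative remainder proves
    it. *)
Lemma sum_oblong_expr_le {R : realType} (N : nat) (t : R) : 0 < t -> t < 1 ->
  \sum_(j < N) (j * j.+1)%:R * t ^+ j <= 2 * t / (1 - t) ^+ 3.
Proof.
move=> t0 t1; have t1' : 0 < 1 - t by lra.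
(* U N is the sum of the remaining terms j >= N of the series. *)
pose U N : R := t ^+ N * ((N * N.+1)%:R / (1 - t) + 2 * N.+1%:R * t / (1 - t) ^+ 2
  + 2 * t ^+ 2 / (1 - t) ^+ 3).
have UE k : U k = (k * k.+1)%:R * t ^+ k + U k.+1.
  rewrite /U [t ^+ k.+1]exprS !natrM -![k.+2%:R]natr1 -![k.+1%:R]natr1.
  by field; exact: lt0r_neq0.
have -> : 2 * t / (1 - t) ^+ 3 = \sum_(j < N) (j * j.+1)%:R * t ^+ j + U N.
  elim: N => [|N IH]; last by rewrite IH big_ord_recr /= -addrA -UE.
  by rewrite big_ord0 /U; field; exact: lt0r_neq0.
rewrite lerDl mulr_ge0 ?exprn_ge0 ?(ltW t0)//.
by rewrite !addr_ge0// !mulr_ge0// ?invr_ge0 ?exprn_ge0 ?(ltW t0) ?(ltW t1').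
Qed.

(** Every coefficient is at most the first one, and a geometric sum remains. *)
Lemma binomial_tail_le {R : realType} (n : nat) (x : R) : 0 < x -> x < 1 / 2 ->
  binomial_tail n (uphalf n) x <= binomial_mid n x / (1 - x / (1 - x)).
Proof.
move=> x0 x1; have /andP[t0 t1] := odds_bounds _ x0 x1.
rewrite binomial_tail_uphalfE /binomial_mid; last by lra.
set t := x / (1 - x) in t0 t1 *.
rewrite -[leRHS]mulrA mulrCA ler_wpM2l//.
  by rewrite mulr_ge0 ?exprn_ge0//; lra.
apply: (@le_trans _ _ ('C(n, uphalf n)%:R * \sum_(j < (n - uphalf n).+1) t ^+ j)).
  rewrite mulr_sumr; apply: ler_sum => j _; rewrite ler_wpM2r ?exprn_ge0 ?(ltW t0)// ler_nat.
  by have /andP[] := bin_uphalf_le n j.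
rewrite ler_wpM2l// sum_expr ?lt_eqF//; apply: ler_piMl; first by rewrite invr_ge0; lra.
by rewrite lerBlDr lerDl exprn_ge0// ltW.
Qed.

(** The two corrections account for truncating the geometric series and for the quadratic decrease
    of the coefficients. *)
Lemma binomial_tail_ge {R : realType} (n : nat) (x : R) (t := x / (1 - x)) :
  (0 < n)%N -> 0 < x -> x < 1 / 2 ->
  binomial_mid n x / (1 - t) *
    (1 - t ^+ uphalf n - 2 * t / (1 - t) ^+ 2 / (uphalf n)%:R)
  <= binomial_tail n (uphalf n) x.
Proof.
move=> n0 x0 x1; have /andP[t0 t1] := odds_bounds _ x0 x1.
rewrite binomial_tail_uphalfE /binomial_mid; last by lra.
rewrite -/t in t0 t1 *.
have t1' : 0 < 1 - t by lra.
have m0 : 0 < (uphalf n)%:R :> R by rewrite ltr0n uphalf_gt0.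
rewrite -[leLHS]mulrA [X in X * _ <= _]mulrC -[leLHS]mulrA ler_wpM2l//.
  by rewrite mulr_ge0 ?exprn_ge0//; lra.
set N := (n - uphalf n).+1.
apply: (@le_trans _ _ ('C(n, uphalf n)%:R *
    \sum_(j < N) (1 - (j * j.+1)%:R / (uphalf n)%:R) * t ^+ j)); last first.
  rewrite mulr_sumr; apply: ler_sum => j _.
  by rewrite mulrA ler_wpM2r ?exprn_ge0 ?(ltW t0)// bin_uphalf_ge.
rewrite ler_wpM2l//.
under eq_bigr do rewrite mulrBl mul1r mulrAC.
rewrite sumrB -mulr_suml sum_expr ?lt_eqF//.
(* There are n - m + 1 >= m terms, where m = [uphalf n]. *)
have tN : t ^+ N <= t ^+ uphalf n.
  by apply: ler_wiXn2l; [exact: ltW|exact: ltW|have [] := uphalf_bounds n].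
have -> : (1 - t)^-1 * (1 - t ^+ uphalf n - 2 * t / (1 - t) ^+ 2 / (uphalf n)%:R) =
   (1 - t ^+ uphalf n) / (1 - t) - 2 * t / (1 - t) ^+ 3 / (uphalf n)%:R.
  by field; rewrite !lt0r_neq0.
apply: lerB.
  by rewrite ler_wpM2r ?invr_ge0 ?(ltW t1')// lerB.
by rewrite ler_wpM2r ?invr_ge0 ?(ltW m0)// sum_oblong_expr_le.
Qed.

Lemma binomial_mid_le {R : realType} (n : nat) (b c : R) :
  0 < c -> c <= b -> b < 1 / 2 ->
  binomial_mid n c <= binomial_mid n b * (c * (1 - c) / (b * (1 - b))) ^+ uphalf n.
Proof.
move=> c0 cb b1; have [_ rm mr] := uphalf_bounds n.
rewrite /binomial_mid -[leRHS]mulrA ler_wpM2l//.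
set r := (n - uphalf n)%N in rm mr *.
have b0 : 0 < b by lra.
have b1' : 0 < 1 - b by lra.
have c1' : 0 < 1 - c by lra.
(* For even n the ratio is an exact power. For odd n a factor (1 - c)/(1 - b) >= 1 is left over. *)
have [e|e] : uphalf n = r \/ uphalf n = r.+1 by lia.
  rewrite e -!exprMn (_ : b * (1 - b) * _ = c * (1 - c))//.
  by field; rewrite !lt0r_neq0.
have A0 : 0 <= (c * (1 - c)) ^+ r by rewrite exprn_ge0// mulr_ge0 ?ltW.
have AE : (c * (1 - c)) ^+ r =
    b ^+ r * (1 - b) ^+ r * (c * (1 - c) / (b * (1 - b))) ^+ r.
  rewrite -!exprMn; congr (_ ^+ _); field; by rewrite !lt0r_neq0.
have -> : c ^+ uphalf n * (1 - c) ^+ r = c * (c * (1 - c)) ^+ r.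
  by rewrite e exprS exprMn mulrA.
have -> : b ^+ uphalf n * (1 - b) ^+ r * (c * (1 - c) / (b * (1 - b))) ^+ uphalf n
    = c * (1 - c) / (1 - b) * (c * (1 - c)) ^+ r.
  by rewrite AE e !exprS; field; rewrite !lt0r_neq0.
apply: ler_wpM2r => //; rewrite ler_pdivlMr// ler_wpM2l//; first exact: ltW.
by lra.
Qed.

(** * Limits and the asymptotic equivalence *)

Lemma cvg_uphalf : uphalf n @[n --> \oo] --> \oo.
Proof.
apply/cvgnyPge => A; exists A.*2 => // n /= An.
by rewrite geq_uphalf_double (leq_trans An).
Qed.

Lemma cvg_natV {R : realType} : (n%:R : R)^-1 @[n --> \oo] --> (0 : R).
Proof.
apply/gtr0_cvgV0; last exact: cvgr_idn.
by exists 1%N => // n /=; rewrite ltr0n.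
Qed.

Lemma cvg_bin_uphalf {R : realType} :
  'C(n, uphalf n)%:R / 2 ^+ n * Num.sqrt (pi * n%:R / 2) @[n --> \oo] --> (1 : R).
Proof.
have L : 1 - 2 * (n%:R : R)^-1 @[n --> \oo] --> (1 : R).
  rewrite -[X in _ --> X]subr0 -[X in _ --> _ - X](mulr0 2).
  by apply: cvgB; [exact: cvg_cst|apply: cvgM; [exact: cvg_cst|exact: cvg_natV]].
apply: (squeeze_cvgr _ L (cvg_cst (1 : R))).
exists 1%N => // n /= n0; have n0R : 0 < n%:R :> R by rewrite ltr0n.
have /andP[] := @bin_uphalf_bounds R n n0.
set b := 'C(_, _)%:R / _.
have y0 : 0 <= pi * n%:R / 2 :> R by rewrite !mulr_ge0 ?pi_ge0.
rewrite -{1 2}(sqr_sqrtr y0) -!exprMn.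
set k := b * _ => lo hi.
have k0 : 0 <= k by rewrite mulr_ge0 ?sqrtr_ge0// divr_ge0 ?exprn_ge0.
have k1 : k <= 1 by rewrite -(@expr_le1 _ 2).
(* As 0 <= k <= 1 gives k^2 <= k, the lower bound on k^2 serves for k without taking a root. *)
rewrite k1 andbT; apply: le_trans (_ : k ^+ 2 <= k); last by rewrite expr2 ler_piMr.
apply: le_trans lo; rewrite ler_pdivlMr// -[n.+2%:R]natr1 -natr1.
rewrite -subr_ge0 (_ : _ - _ = 4 / n%:R); first by rewrite divr_ge0// ltW.
by field; exact: lt0r_neq0.
Qed.

(** A factor [u] with eventual equality, rather than the quotient f/g, avoids dividing by [g]. *)
Lemma equiv_of_cvg1 {R : realType} (f g u : nat -> R) :
  (\forall n \near \oo, f n = g n * u n) -> u @ \oo --> (1 : R) -> f ~_\oo g.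
Proof.
move=> fE u1; apply/eqaddoP => e e0.
near=> n.
rewrite !fctE (near fE n)//.
have -> : g n * u n - g n = g n * (u n - 1) by ring.
rewrite normrM mulrC ler_wpM2r//.
near: n; have /cvgrPdist_le/(_ e e0) := u1.
by apply: filterS => n; rewrite distrC.
Unshelve. all: by end_near.
Qed.

Lemma binomial_mid_gt0 {R : realType} (n : nat) (x : R) : 0 < x -> x < 1 ->
  0 < binomial_mid n x.
Proof.
move=> x0 x1; have [mn _ _] := uphalf_bounds n.
rewrite /binomial_mid mulr_gt0 ?ltr0n ?bin_gt0// mulr_gt0 ?exprn_gt0//; lra.
Qed.

Lemma lose_bounds {R : realType} (q : R) : 0 < q -> q < 1 ->
  [/\ 0 < lose13 q, lose13 q < lose23 q & lose23 q < 1 / 2].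
Proof.
move=> q0 q1; rewrite /lose13 /lose23; split.
- by rewrite divr_gt0 ?mulr_gt0 ?exprn_gt0 ?addr_gt0 ?exprn_gt0.
- rewrite -subr_gt0 (_ : _ - _ = q * (1 - q) / ((1 + q) * (1 + q + q ^+ 2))).
    by rewrite divr_gt0 ?mulr_gt0 ?subr_gt0 ?addr_gt0 ?exprn_gt0.
  by field; rewrite !lt0r_neq0 ?addr_gt0 ?exprn_gt0.
- by rewrite ltr_pdivrMr; lra.
Qed.

Lemma lose23_odds {R : realType} (q : R) : 0 < q ->
  lose23 q / (1 - lose23 q) = q.
Proof.
move=> q0; rewrite /lose23; field; rewrite lt0r_neq0; last lra.
by rewrite andbC /=; lra.
Qed.

(** Squeeze: the tail at [lose23 q] gives the limit 1 on both sides, and the tail at [lose13 q] adds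
    only an exponentially small term to the upper bound. *)
Lemma cvg_prob_not_condorcet3 {R : realType} (rho : R) (q := expR (- rho)) :
  0 < rho ->
  (1 - prob_condorcet3 rho n) * (1 - q) / binomial_mid n (lose23 q)
    @[n --> \oo] --> (1 : R).
Proof.
move=> rho0.
have q0 : 0 < q by exact: expR_gt0.
have q1 : q < 1 by rewrite /q expR_lt1 oppr_lt0.
have [c0 cb b1] := lose_bounds _ q0 q1.
set b := lose23 q in cb b1 *; set c := lose13 q in c0 cb.
have b0 : 0 < b by lra.
have bq : b / (1 - b) = q by exact: lose23_odds.
have c1 : c < 1 / 2 by lra.
have /andP[tc0 tc1] := odds_bounds _ c0 c1.
(* The decay rate of the second tail relative to the first; z < 1 because b(1 - b) - c(1 - c) = (b -
   c)(1 - b - c) > 0. *)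
pose z := c * (1 - c) / (b * (1 - b)).
have B0 : 0 < b * (1 - b) by rewrite mulr_gt0//; lra.
have z0 : 0 <= z by rewrite divr_ge0 ?(ltW B0)// mulr_ge0//; lra.
have z1 : z < 1.
  rewrite ltr_pdivrMr// mul1r -subr_gt0.
  by rewrite (_ : _ - _ = (b - c) * (1 - b - c)); [rewrite mulr_gt0//; lra|ring].
have cvgX (x : R) : 0 <= x -> x < 1 -> x ^+ uphalf n @[n --> \oo] --> (0 : R).
  move=> x0 x1; apply: (cvg_comp uphalf (fun m => x ^+ m)); first exact: cvg_uphalf.
  by apply: cvg_expr; rewrite ger0_norm.
pose K := 2 * q / (1 - q) ^+ 2.
have L : 1 - q ^+ uphalf n - K / (uphalf n)%:R @[n --> \oo] --> (1 : R).
  rewrite -[X in _ --> X]subr0 -[X in _ --> X - _]subr0 -[X in _ --> _ - X](mulr0 K).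
  apply: cvgB; first by apply: cvgB; [exact: cvg_cst|apply: cvgX => //; exact: ltW].
  apply: cvgM; first exact: cvg_cst.
  by apply: (cvg_comp uphalf (fun m => (m%:R : R)^-1)); [exact: cvg_uphalf|exact: cvg_natV].
have U : 1 + (1 - q) / (1 - c / (1 - c)) * z ^+ uphalf n @[n --> \oo] --> (1 : R).
  rewrite -[X in _ --> X]addr0 -[X in _ --> _ + X](mulr0 ((1 - q) / (1 - c / (1 - c)))).
  apply: cvgD; first exact: cvg_cst.
  by apply: cvgM; [exact: cvg_cst|exact: cvgX].
apply: (squeeze_cvgr _ L U).
exists 1%N => // n /= n0.
have M0 : 0 < binomial_mid n b by apply: binomial_mid_gt0; lra.
have q1' : 0 < 1 - q by lra.
have lo := binomial_tail_ge _ _ n0 b0 b1; rewrite bq -/K in lo.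
have lo' := prob_not_condorcet3_ge rho n; rewrite -/q -/b in lo'.
have hi := prob_not_condorcet3_le rho n; rewrite -/q -/b -/c in hi.
have hib := binomial_tail_le n _ b0 b1; rewrite bq in hib.
have hic := binomial_tail_le n _ c0 c1.
have hiM := binomial_mid_le n _ _ c0 (ltW cb) b1; rewrite -/z in hiM.
have tc1' : 0 < 1 - c / (1 - c) by rewrite subr_gt0.
apply/andP; split.
  rewrite ler_pdivlMr// -ler_pdivrMr//; apply: le_trans (le_trans lo lo').
  by rewrite le_eqVlt; apply/orP; left; apply/eqP; ring.
rewrite ler_pdivrMr// -ler_pdivlMr//; apply: (le_trans hi).
have hic' : binomial_tail n (uphalf n) c <=
    binomial_mid n b * z ^+ uphalf n / (1 - c / (1 - c)).
  by apply: (le_trans hic); rewrite ler_wpM2r// invr_ge0 ltW.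
apply: (le_trans (lerD hib hic')).
rewrite le_eqVlt; apply/orP; left; apply/eqP.
have := lt0r_neq0 tc1'; set w := 1 - c / (1 - c) => w0.
by field; rewrite w0 lt0r_neq0.
Qed.

Theorem theorem9 (R : realType) (rho : R) (hrho : 0 < rho) :
  (fun n : nat => 1 - prob_condorcet3 rho n)
  ~_\oo
  (fun n : nat => Num.sqrt (2 / (pi * n%:R)) *
                  (expR (- rho * (uphalf n)%:R) / (1 - expR (- rho))) *
                  (2 / (1 + expR (- rho))) ^+ n).
Proof.
set q := expR (- rho).
have q0 : 0 < q by exact: expR_gt0.
have q1 : q < 1 by rewrite /q expR_lt1 oppr_lt0.
have [c0 cb b1] := lose_bounds _ q0 q1.
(* [k] carries the Wallis asymptotics and [v] the comparison with the first term of the tail; both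
   tend to 1. *)
pose k n : R := 'C(n, uphalf n)%:R / 2 ^+ n * Num.sqrt (pi * n%:R / 2).
pose v n : R := (1 - prob_condorcet3 rho n) * (1 - q) / binomial_mid n (lose23 q).
apply: (@equiv_of_cvg1 _ _ _ (fun n => k n * v n)); last first.
  rewrite -[X in _ --> X]mulr1; apply: cvgM; first exact: cvg_bin_uphalf.
  exact: cvg_prob_not_condorcet3.
(* At n = 0 the division by zero makes the right side 0, while the failure probability is 1. *)
exists 1%N => // n /= n0.
have M0 : 0 < binomial_mid n (lose23 q) by apply: binomial_mid_gt0; lra.
have y0 : 0 < pi * n%:R / 2 :> R by rewrite divr_gt0// mulr_gt0 ?pi_gt0 ?ltr0n.
have s1 : Num.sqrt (2 / (pi * n%:R)) * Num.sqrt (pi * n%:R / 2) = 1 :> R.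
  rewrite -sqrtrM; last by rewrite -invf_div invr_ge0 ltW.
  by rewrite -invf_div mulVf ?sqrtr1// lt0r_neq0.
(* With b = q/(1 + q), b^m (1 - b)^(n - m) = q^m/(1 + q)^n; factors 2^n are inserted to match [k]
   and the claimed formula. *)
have ME : binomial_mid n (lose23 q) =
    'C(n, uphalf n)%:R / 2 ^+ n * q ^+ uphalf n * (2 / (1 + q)) ^+ n.
  have [mn _ _] := uphalf_bounds n.
  have q1' : 1 + q != 0 by rewrite lt0r_neq0//; lra.
  have -> : binomial_mid n (lose23 q) = 'C(n, uphalf n)%:R * (q ^+ uphalf n / (1 + q) ^+ n).
    rewrite /binomial_mid (_ : 1 - lose23 q = (1 + q)^-1); last first.
      by rewrite /lose23; field.
    by rewrite /lose23 expr_div_n exprVn -mulrA -invfM -exprD subnKC.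
  by rewrite expr_div_n; field; rewrite !expf_neq0.
have expE : expR (- rho * (uphalf n)%:R) = q ^+ uphalf n by rewrite expRM_natr.
rewrite expE.
transitivity (Num.sqrt (2 / (pi * n%:R)) * Num.sqrt (pi * n%:R / 2) *
  (1 - prob_condorcet3 rho n)); first by rewrite s1 mul1r.
rewrite /k /v ME.
have Mn : 'C(n, uphalf n)%:R / 2 ^+ n * q ^+ uphalf n * (2 / (1 + q)) ^+ n != 0.
  by rewrite -ME lt0r_neq0.
move: Mn; rewrite !mulf_eq0 !negb_or invr_eq0 => /andP[/andP[/andP[C0 p0] qm0] r0].
have q1' : 1 - q != 0 by rewrite lt0r_neq0//; lra.
by field; rewrite C0 p0 qm0 q1' r0.
Qed.
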